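(* Let $q_1,q_2$ be integers with $1\le q_1\le q_2$, let $A=\begin{pmatrix}3q_1&0\\0&3q_2\end{pmatrix}$, $\mathcal{D}=\left\{\begin{pmatrix}0\\0\end{pmatrix},\begin{pmatrix}1\\0\end{pmatrix},\begin{pmatrix}0\\1\end{pmatrix}\right\}$, and let $\mu_{A,\mathcal{D}}$ be the Sierpiński-type self-affine measure defined below. Let $\Lambda$ be a countable subset of $\mathbb{R}^2$ containing $\mathbf{0}$. Then $\Lambda$ is a maximal orthogonal set of $\mu_{A,\mathcal{D}}$ if and only if there exists a maximal tree mapping $\tau$ such that $\Lambda=\tau^*(\Theta_3^\tau)$.
   Context: $\mu_{A,\mathcal{D}}$ is the unique Borel probability measure on $\mathbb{R}^2$ satisfying $\mu_{A,\mathcal{D}}(E)=\frac13\sum_{d\in\mathcal{D}}\mu_{A,\mathcal{D}}(AE-d)$ for all Borel sets $E$. A countable set $\Lambda\subseteq\mathbb{R}^2$ is an orthogonal set of a probability measure $\mu$ if the functions $e_\lambda(x)=e^{-2\pi i\langle\lambda,x\rangle}$, $\lambda\in\Lambda$, are mutually orthogonal in $L^2(\mu)$; it is a maximal orthogonal set if it is an orthogonal set not properly contained in any other orthogonal set of $\mu$. Notation: $\Gamma_{q_1,q_2}=\{(k,l)^T\in\mathbb{Z}^2: -\frac{3q_1}{2}\le k<\frac{3q_1}{2},\ -\frac{3q_2}{2}\le l<\frac{3q_2}{2}\}$ (a complete residue system of $\mathbb{Z}^2$ modulo $A\mathbb{Z}^2$); for $x,y\in\mathbb{Z}^2$, $x\equiv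 y\pmod A$ means $x-y\in A\mathbb{Z}^2$. $\mathcal{E}_{q_1}=\{(a_1,a_2)^T\in\Gamma_{q_1,q_2}: -\frac{q_1}{2}\le a_1<\frac{q_1}{2}\}$. $\Theta_3=\{-1,0,1\}$, $\Theta_3^n$ the words of length $n$ over $\Theta_3$, $\Theta_3^*=\bigcup_{n\ge1}\Theta_3^n$, $\Theta_3^\infty$ the infinite words; $IJ$ denotes concatenation, $0^k$ the word of $k$ zeros, $I|_k$ the prefix of length $k$. A maximal tree mapping is a map $\tau:\Theta_3^*\to\Gamma_{q_1,q_2}$ such that: (i) $\tau(0^k i)=i\begin{pmatrix}q_1\\-q_2\end{pmatrix}$ for all $k\ge0$ and $i\in\Theta_3$ (with $0^0i=i$); (ii) for every $k\ge1$ and every $I\in\Theta_3^k$ with $I\ne0^k$ there is $e_I\in\mathcal{E}_{q_1}$ such that $\tau(Ij)\equiv e_I+j\begin{pmatrix}q_1\\-q_2\end{pmatrix}\pmod A$ for all $j\in\Theta_3$; (iii) for every $I\in\Theta_3^*$ there exists $J\in\Theta_3^*$ such that $\tau(IJ0^n)=\mathbf{0}$ for all sufficiently large $n$. For such $\tau$, $\Theta_3^\tau=\{I\in\Theta_3^\infty:\tau(I|_n)=\mathbf{0}\text{ for all sufficiently large }n\}$, and for $I\in\Theta_3^\tau$, $\tau^*(I)=\sum_{k=1}^\infty A^{k-1}\tau(I|_k)\in\mathbb{Z}^2$; $\tau^*(\Theta_3^\tau)=\{\tau^*(I):I\in\Theta_3^\tau\}$. *)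

(* Defs.v *)
From HB Require Import structures.
From mathcomp Require Import all_boot all_order all_algebra.
From mathcomp Require Import all_classical all_reals all_analysis.
Set Implicit Arguments. Unset Strict Implicit. Unset Printing Implicit Defensive.
Import Order.TTheory GRing.Theory Num.Theory.
Local Open Scope classical_set_scope.
Local Open Scope ring_scope.

Section Measure.
Variable R : realType.

Definition affAd (q1 q2 : nat) (d : R * R) (x : R * R) : R * R :=
  ((3 * q1)%:R * x.1 - d.1, (3 * q2)%:R * x.2 - d.2).

Definition sierpinski_invariant (q1 q2 : nat) (mu : probability (R * R)%type R) :=
  forall E : set (R * R), measurable E ->
    (mu E = ((3 : R)^-1)%:E *
      (mu (affAd q1 q2 (0%R, 0%R) @` E) + mu (affAd q1 q2 (1%R, 0%R) @` E)
       + mu (affAd q1 q2 (0%R, 1%R) @` E)))%E.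

Definition dotR2 (x y : R * R) : R := x.1 * y.1 + x.2 * y.2.

(* <e_l, e_l'>_{L^2(mu)} = int exp(-2 pi i <l - l', x>) dmu(x) = 0,
   written as: real part and imaginary part both vanish. *)
Definition exp_orth (mu : probability (R * R)%type R) (l l' : R * R) :=
  (\int[mu]_x (cos (2 * pi * dotR2 (l.1 - l'.1, l.2 - l'.2) x))%:E = 0)%E /\
  (\int[mu]_x (sin (2 * pi * dotR2 (l.1 - l'.1, l.2 - l'.2) x))%:E = 0)%E.

Definition orthogonal_set (mu : probability (R * R)%type R) (L : set (R * R)) :=
  countable L /\ forall l l', L l -> L l' -> l <> l' -> exp_orth mu l l'.

Definition maximal_orthogonal_set (mu : probability (R * R)%type R) (L : set (R * R)) :=
  orthogonal_set mu L /\
  forall L' : set (R * R), orthogonal_set mu L' -> L `<=` L' -> L' = L.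

Definition embZ2 (z : int * int) : R * R := (z.1%:~R, z.2%:~R).
End Measure.

(* Theta_3 = {-1,0,1} encoded by 'I_3 via i |-> i - 1. *)
Definition digit (i : 'I_3) : int := (i : nat)%:Z - 1.
Definition zero3 : 'I_3 := @Ordinal 3 1 isT.

Definition in_Gamma (q1 q2 : nat) (z : int * int) : Prop :=
  - (3 * q1)%:Z <= 2 * z.1 /\ 2 * z.1 < (3 * q1)%:Z /\
  - (3 * q2)%:Z <= 2 * z.2 /\ 2 * z.2 < (3 * q2)%:Z.

Definition in_E (q1 q2 : nat) (z : int * int) : Prop :=
  in_Gamma q1 q2 z /\ - (q1%:Z) <= 2 * z.1 /\ 2 * z.1 < q1%:Z.

Definition congA (q1 q2 : nat) (x y : int * int) : Prop :=
  (((3 * q1)%:Z %| x.1 - y.1)%Z /\ ((3 * q2)%:Z %| x.2 - y.2)%Z).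

Definition vq (q1 q2 : nat) (i : 'I_3) : int * int :=
  (digit i * q1%:Z, - (digit i * q2%:Z)).

Definition zero2 : int * int := (0, 0).

(* A maximal tree mapping tau : Theta_3^* -> Gamma (values on the empty
   word are irrelevant and unconstrained). *)
Definition maximal_tree_mapping (q1 q2 : nat) (tau : seq 'I_3 -> int * int) : Prop :=
  (forall I, (0 < size I)%N -> in_Gamma q1 q2 (tau I)) /\
  (forall (k : nat) (i : 'I_3), tau (nseq k zero3 ++ [:: i]) = vq q1 q2 i) /\
  (forall I : seq 'I_3, (1 <= size I)%N -> I <> nseq (size I) zero3 ->
     exists e, in_E q1 q2 e /\
       forall j : 'I_3, congA q1 q2 (tau (rcons I j))
                         (e.1 + (vq q1 q2 j).1, e.2 + (vq q1 q2 j).2)) /\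
  (forall I : seq 'I_3, (1 <= size I)%N ->
     exists J : seq 'I_3, (1 <= size J)%N /\
       exists N : nat, forall n, (N <= n)%N -> tau (I ++ J ++ nseq n zero3) = zero2).

Definition prefix (I : nat -> 'I_3) (n : nat) : seq 'I_3 := mkseq I n.

Definition in_Theta_tau (tau : seq 'I_3 -> int * int) (I : nat -> 'I_3) : Prop :=
  exists N : nat, forall n, (N <= n)%N -> tau (prefix I n) = zero2.

Definition tau_partial (q1 q2 : nat) (tau : seq 'I_3 -> int * int)
    (I : nat -> 'I_3) (N : nat) : int * int :=
  (\sum_(k < N) ((3 * q1) ^ k)%:Z * (tau (prefix I k.+1)).1,
   \sum_(k < N) ((3 * q2) ^ k)%:Z * (tau (prefix I k.+1)).2).

(* tau^*(I) = z : the series sum_{k>=1} A^{k-1} tau(I|_k) converges in Z^2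
   (discrete) to z, i.e. its partial sums are eventually equal to z. *)
Definition tau_star_is (q1 q2 : nat) (tau : seq 'I_3 -> int * int)
    (I : nat -> 'I_3) (z : int * int) : Prop :=
  exists N0 : nat, forall N, (N0 <= N)%N -> tau_partial q1 q2 tau I N = z.

Definition tau_star_set (R : realType) (q1 q2 : nat) (tau : seq 'I_3 -> int * int)
  : set (R * R) :=
  [set x | exists I : nat -> 'I_3, in_Theta_tau tau I /\
             exists z, tau_star_is q1 q2 tau I z /\ x = embZ2 R z].
Arguments tau_star_set R q1 q2 tau : clear implicits.

(* Main.v *)
(** Since [mu] is invariant, its Fourier transform satisfies
    [muhat xi = m (A^-1 xi) * muhat (A^-1 xi)] where
    [m (a, b) = (1 + e^(-2 i pi a) + e^(-2 i pi b)) / 3], and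
    [muhat (A^-n xi)] tends to [1]; hence [muhat xi = 0] exactly when some
    [A^-n xi] with [n >= 1] is a zero of [m], i.e. when
    [xi = A^k (t v + A z)] with [v = (q1, - q2)], [z] integral, [k >= 0] and [3]
    not dividing [t].  Orthogonality of [l] and [l'] thus means: [l - l'] is
    integral, and at the first [k] where [l] and [l'] differ modulo [A^(k+1)]
    their [k]-th digits differ by a nonzero multiple of [v] modulo [A].  A
    maximal tree mapping is a full ternary tree of such digits, every node of
    which carries a finite expansion.  An integer vector orthogonal to all its
    finite branches must itself follow a branch, whence maximality; conversely
    a maximal set is full, because a missing child [x + t A^k v] of a node
    could be added to it. *)
Require Import Defs.
From HB Require Import structures.
From mathcomp Require Import all_boot all_order all_algebra.
From mathcomp Require Import all_classical all_reals all_analysis.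
From mathcomp Require Import measurable_realfun ring lra zify.
Set Implicit Arguments. Unset Strict Implicit. Unset Printing Implicit Defensive.
Import Order.TTheory GRing.Theory Num.Theory.
Import numFieldNormedType.Exports.
Local Open Scope classical_set_scope.
Local Open Scope ring_scope.

(** * Zeros of the mask polynomial *)

Section MaskZeros.
Variable R : realType.
Implicit Types a b : R.

Lemma cos_sin_2piDint a (n : int) :
  cos (2 * pi * (a + n%:~R)) = cos (2 * pi * a) /\
  sin (2 * pi * (a + n%:~R)) = sin (2 * pi * a).
Proof.
have key x (m : nat) : cos (2 * pi * (x + m%:R)) = cos (2 * pi * x) /\
    sin (2 * pi * (x + m%:R)) = sin (2 * pi * x) :> R.
  elim: m => [|m [IHc IHs]]; first by rewrite addr0.
  have -> : 2 * pi * (x + m.+1%:R) = 2 * pi * (x + m%:R) + pi *+ 2 :> R.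
    by rewrite -natr1; ring.
  by rewrite cosD2pi sinD2pi.
case: n => m; first by rewrite -pmulrn; exact: key.
have [hc hs] := key (a + (Negz m)%:~R) m.+1.
rewrite -hc -hs NegzE mulrNz -pmulrn.
by have -> : a - m.+1%:R + m.+1%:R = a by ring.
Qed.

(** With f the fractional part of a, the double-angle formula turns cos (2 pi f) = 1 into sin (pi f)
    = 0, while sin is positive strictly between 0 and pi; so f = 0. *)
Lemma cos_2pi_eq1 a : cos (2 * pi * a) = 1 <-> exists n : int, a = n%:~R.
Proof.
split=> [ca|[n ->]]; last first.
  by have [+ _] := cos_sin_2piDint 0 n; rewrite add0r mulr0 cos0.
exists (Num.floor a).
have /andP[] := Num.Theory.floor_itv a.
set n := Num.floor a => na an.
pose f := a - n%:~R.
have f0 : 0 <= f by rewrite subr_ge0.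
have f1 : f < 1 by rewrite ltrBlDl -[X in _ + X]/(1%:~R) -intrD.
have cf : cos (2 * pi * f) = 1.
  have [+ _] := cos_sin_2piDint f n.
  by rewrite /f subrK => <-.
apply/eqP; rewrite -subr_eq0; apply/negPn/negP => fn0.
have f_gt0 : 0 < f by rewrite lt_neqAle eq_sym fn0.
have : 0 < sin (pi * f).
  apply: sin_gt0_pi; rewrite mulr_gt0 ?pi_gt0//=.
  by rewrite -[X in _ < X]mulr1 ltr_pM2l ?pi_gt0.
have e2 : 2 * pi * f = (pi * f) *+ 2 by ring.
move: cf; rewrite e2 cos_mulr2n cos2sin2 => h.
have -> : sin (pi * f) = 0; last by rewrite ltxx.
by apply/eqP; rewrite -sqrf_eq0; apply/eqP; lra.
Qed.

Lemma cos_mul3 (x : R) : cos (3 * x) = 4 * cos x ^+ 3 - 3 * cos x.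
Proof.
have -> : 3 * x = x *+ 2 + x by ring.
rewrite cosD cos_mulr2n sin_mulr2n.
have := sin2cos2 x; set c := cos x; set s := sin x => h.
by have -> : (c * s) *+ 2 * s = 2 * c * s ^+ 2 by [ring]; rewrite h; ring.
Qed.

(* [1 + e^(-2 i pi a) + e^(-2 i pi b)] is [mask_re a b - i * mask_im a b]. *)
Definition mask_re a b : R := 1 + cos (2 * pi * a) + cos (2 * pi * b).
Definition mask_im a b : R := sin (2 * pi * a) + sin (2 * pi * b).

(* Both angles turn out to have cosine [-1/2], so that [cos (3 x) = 1]. *)
Lemma mask_eq0 a b : mask_re a b = 0 /\ mask_im a b = 0 <->
  exists n p : int, [/\ ~~ (3 %| n)%Z, 3 * a = n%:~R & a + b = p%:~R].
Proof.
rewrite /mask_re /mask_im; split=> [[hc hs]|[n [p [n3 an abp]]]].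
  have := cos2Dsin2 (2 * pi * a); have := cos2Dsin2 (2 * pi * b).
  have cb : cos (2 * pi * b) = - 1 - cos (2 * pi * a) by lra.
  have sb : sin (2 * pi * b) = - sin (2 * pi * a) by lra.
  rewrite cb sb; set c := cos (2 * pi * a); set s := sin (2 * pi * a) => hb ha.
  (* Subtracting [ha] from [hb] leaves 1 + 2 c = 0. *)
  have c_half : c = - 2^-1.
    by nra.
  have s2 : s ^+ 2 = 3 / 4.
    by move: ha; rewrite c_half => h; nra.
  have /cos_2pi_eq1[n an] : cos (2 * pi * (3 * a)) = 1.
    have -> : 2 * pi * (3 * a) = 3 * (2 * pi * a) by ring.
    by rewrite cos_mul3 -/c c_half; field.
  have /cos_2pi_eq1[p abp] : cos (2 * pi * (a + b)) = 1.
    rewrite mulrDr cosD cb sb -/c -/s c_half.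
    have -> : - 2^-1 * (-1 - - 2^-1) - s * - s = 4^-1 + s ^+ 2 by field.
    by rewrite s2; field.
  exists n, p; split=> //; apply/negP => /dvdzP[m nm].
  suff : c = 1 by rewrite c_half => h; lra.
  apply/cos_2pi_eq1; exists m; move: an; rewrite nm intrM => h.
  have -> : a = (3 * a) / 3 by field.
  by rewrite h; field.
have -> : b = - a + p%:~R by rewrite -abp; ring.
have [-> ->] := cos_sin_2piDint (- a) p.
rewrite mulrN cosN sinN subrr; split=> //.
set c := cos _.
have c3 : 4 * c ^+ 3 - 3 * c = 1.
  rewrite -cos_mul3; have -> : 3 * (2 * pi * a) = 2 * pi * (3 * a) by ring.
  by apply/cos_2pi_eq1; exists n.
have cn1 : c - 1 != 0.
  apply/eqP => c1; have /cos_2pi_eq1[m am] : c = 1 by lra.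
  move/negP: n3; apply; apply/dvdzP; exists m.
  by apply: (@intr_inj R); rewrite intrM -an am mulrC.
(* The product expands to 4 c^3 - 3 c - 1; the root c = 1 was excluded because 3 does not divide
   n. *)
have : (c - 1) * (2 * c + 1) ^+ 2 = 0.
  by nra.
move/eqP; rewrite mulf_eq0 (negPf cn1)/= sqrf_eq0 => /eqP h.
by rewrite -h; ring.
Qed.

End MaskZeros.

(** * The Fourier transform of the invariant measure and its zeros *)

Lemma integrable_measure_add d (T : measurableType d) (R : realType)
    (m1 m2 : measure T R) (f : T -> \bar R) :
  m1.-integrable setT f -> m2.-integrable setT f ->
  (measure_add m1 m2).-integrable setT f.
Proof.
move=> /integrableP[mf f1] /integrableP[_ f2]; apply/integrableP; split=> //.
rewrite ge0_integral_measure_add//; first exact: lte_add_pinfty.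
exact: measurableT_comp.
Qed.

Section FourierTransform.
Variables (R : realType) (mu : probability (R * R)%type R).
Implicit Types (xi d x : R * R) (f : R * R -> R).

Lemma integrable_bounded1 f : measurable_fun setT f ->
  (forall x, `|f x| <= 1) -> mu.-integrable setT (EFin \o f).
Proof.
move=> mf f1; apply: (@le_integrable _ _ _ _ _ measurableT _ (EFin \o cst 1)).
- exact/measurable_EFinP.
- by move=> x _; rewrite !abse_EFin lee_fin [leRHS]ger0_norm.
- exact: finite_measure_integrable_cst.
Qed.

Lemma measurable_cos_dot xi :
  measurable_fun setT (fun x => cos (2 * pi * dotR2 xi x)).
Proof.
apply: measurableT_comp.
  by apply: continuous_measurable_fun; exact: continuous_cos.
apply: measurable_funM => //; apply: measurable_funD; apply: measurable_funM => //.
Qed.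

Lemma measurable_sin_dot xi :
  measurable_fun setT (fun x => sin (2 * pi * dotR2 xi x)).
Proof.
apply: measurableT_comp.
  by apply: continuous_measurable_fun; exact: continuous_sin.
apply: measurable_funM => //; apply: measurable_funD; apply: measurable_funM => //.
Qed.

Lemma integrable_cos_dot xi :
  mu.-integrable setT (EFin \o (fun x => cos (2 * pi * dotR2 xi x))).
Proof.
apply: integrable_bounded1; first exact: measurable_cos_dot.
by move=> x; exact: cos_max.
Qed.

Lemma integrable_sin_dot xi :
  mu.-integrable setT (EFin \o (fun x => sin (2 * pi * dotR2 xi x))).
Proof.
apply: integrable_bounded1; first exact: measurable_sin_dot.
by move=> x; exact: sin_max.
Qed.

Definition fourier_cos xi : R := \int[mu]_x cos (2 * pi * dotR2 xi x).
Definition fourier_sin xi : R := \int[mu]_x sin (2 * pi * dotR2 xi x).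

(** The squared modulus of the Fourier transform: it vanishes exactly when both parts do, and it
    makes the functional equation multiplicative over the reals. *)
Definition fourier_sqnorm xi : R := fourier_cos xi ^+ 2 + fourier_sin xi ^+ 2.

Lemma exp_orthE l l' :
  exp_orth mu l l' <-> fourier_sqnorm (l.1 - l'.1, l.2 - l'.2) = 0.
Proof.
rewrite /exp_orth /fourier_sqnorm /fourier_cos /fourier_sin /Rintegral.
set xi := (l.1 - _, _).
rewrite -[X in X = 0%E /\ _](fineK (integrable_fin_num measurableT (integrable_cos_dot xi))).
rewrite -[X in _ /\ X = 0%E](fineK (integrable_fin_num measurableT (integrable_sin_dot xi))).
split=> [[[->] [->]]|/eqP]; first by rewrite expr0n addr0.
by rewrite paddr_eq0 ?sqr_ge0// !sqrf_eq0 => /andP[/eqP -> /eqP ->].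
Qed.

Lemma fourier_cos_cvg1 (u : nat -> R * R) :
  (u n).1 @[n --> \oo] --> 0 -> (u n).2 @[n --> \oo] --> 0 ->
  fourier_cos (u n) @[n --> \oo] --> (1 : R).
Proof.
move=> u1 u2.
have : (\int[mu]_x (cos (2 * pi * dotR2 (u n) x))%:E)%E @[n --> \oo]
    --> (\int[mu]_x (cst 1%:E x))%E.
  apply: (@dominated_cvg _ _ _ _ _ measurableT _ _ (EFin \o cst 1)) => //.
  - by move=> n; apply/measurable_EFinP; exact: measurable_cos_dot.
  - move=> x _; apply: cvg_EFin; first by apply: nearW.
    have h : 2 * pi * ((u n).1 * x.1 + (u n).2 * x.2) @[n --> \oo]
        --> 2 * pi * (0 * x.1 + 0 * x.2).
      apply: (cvgM (cvg_cst _)).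
      exact: (cvgD (cvgM u1 (cvg_cst _)) (cvgM u2 (cvg_cst _))).
    have := cvg_comp _ _ h (@continuous_cos R _).
    by rewrite !mul0r addr0 mulr0 cos0.
  - exact: finite_measure_integrable_cst.
  - by move=> n x _; rewrite abse_EFin lee_fin; exact: cos_max.
rewrite integral_cst// mul1e => h.
by apply: fine_cvg; rewrite -(probability_setT mu).
Qed.

Variables q1 q2 : nat.
Hypotheses (q1_gt0 : (0 < q1)%N) (q2_gt0 : (0 < q2)%N).

(** The inverse of [affAd]: images under [affAd] become preimages, so invariance can be read on
    pushforward measures. *)
Definition contraction d x : R * R :=
  ((x.1 + d.1) / (3 * q1)%:R, (x.2 + d.2) / (3 * q2)%:R).

Lemma measurable_contraction d : measurable_fun setT (contraction d).
Proof.
by apply: measurable_fun_pair; apply: measurable_funM => //;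
  apply: measurable_funD.
Qed.

Let b1_neq0 : (3 * q1)%:R != 0 :> R.
Proof. by rewrite pnatr_eq0; lia. Qed.
Let b2_neq0 : (3 * q2)%:R != 0 :> R.
Proof. by rewrite pnatr_eq0; lia. Qed.

Lemma affAd_image d (E : set (R * R)) :
  affAd q1 q2 d @` E = contraction d @^-1` E.
Proof.
apply/seteqP; split=> [_ [x Ex <-]|x /= Ex].
  rewrite /preimage /contraction /affAd /= !subrK.
  by rewrite [_%:R * x.1]mulrC [_%:R * x.2]mulrC !mulfK//; case: x Ex.
exists (contraction d x) => //; rewrite /affAd /contraction/=.
by rewrite [_%:R * (_ / _)]mulrC [in X in (_, X - _)]mulrC !divfK// !addrK; case: x Ex.
Qed.

Hypothesis mu_inv : sierpinski_invariant q1 q2 mu.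

(** Multiplied by 3, invariance says that [mu + mu + mu] and the sum of the three pushforwards of
    [mu] agree on measurable sets, so both integrate [f] to the same value. *)
Lemma invariant_Rintegral f : measurable_fun setT f ->
  (forall x, `|f x| <= 1) ->
  3 * \int[mu]_x f x = \int[mu]_x f (contraction (0, 0) x) +
    \int[mu]_x f (contraction (1, 0) x) + \int[mu]_x f (contraction (0, 1) x).
Proof.
move=> mf f1.
have mEf : measurable_fun setT (EFin \o f) by exact/measurable_EFinP.
have intf := integrable_bounded1 mf f1.
have intfd d : mu.-integrable setT (EFin \o (f \o contraction d)).
  apply: integrable_bounded1 => [|x]; last exact: f1.
  by apply: measurableT_comp => //; exact: measurable_contraction.
(* [p0] abstracts over the measurability proof required by [pushforward]. *)
pose p0 d : measure (R * R)%type R := pushforward mu (contraction d).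
pose p := p0 measurable_contraction.
have intp d : (p d).-integrable setT (EFin \o f).
  apply: integrable_pushforward => //; first exact: measurable_contraction.
  by rewrite preimage_setT; exact: intfd.
have intpE d : (\int[p d]_x (EFin \o f) x = \int[mu]_x (f (contraction d x))%:E)%E.
  rewrite integral_pushforward//; first exact: measurable_contraction.
  by rewrite preimage_setT; exact: intfd.
have fin3 (a b c e : R) : a = 3^-1 * (b + c + e) -> a + a + a = b + c + e.
  by move=> ->; field.
have muE (A : set (R * R)) : measurable A -> mu A = (fine (mu A))%:E.
  by move=> mA; rewrite fineK// fin_num_measure.
have mpre d A : measurable A -> measurable (contraction d @^-1` A).
  by move=> mA; rewrite -[X in measurable X]setTI; exact: measurable_contraction.
have eq_add A : measurable A -> A `<=` setT ->
    measure_add (measure_add mu mu) mu A =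
    measure_add (measure_add (p (0, 0)) (p (1, 0))) (p (0, 1)) A.
  move=> mA _.
  rewrite !measure_addE [X in (X + _)%E = _]measure_addE.
  rewrite [X in _ = (X + _)%E]measure_addE.
  have := mu_inv mA; rewrite !affAd_image.
  rewrite (muE _ mA) (muE _ (mpre (0, 0) _ mA)) (muE _ (mpre (1, 0) _ mA)).
  rewrite (muE _ (mpre (0, 1) _ mA)) -!EFinD -EFinM => -[/fin3 h].
  suff : (mu A + mu A + mu A = mu (contraction (0, 0)%R @^-1` A) +
    mu (contraction (1, 0)%R @^-1` A) + mu (contraction (0, 1)%R @^-1` A))%E by [].
  rewrite (muE _ mA) (muE _ (mpre (0, 0) _ mA)) (muE _ (mpre (1, 0) _ mA)).
  by rewrite (muE _ (mpre (0, 1) _ mA)) -!EFinD h.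
have := @eq_measure_integral _ _ _ setT
  (measure_add (measure_add (p (0, 0)) (p (1, 0))) (p (0, 1)))
  (measure_add (measure_add mu mu) mu) (EFin \o f) eq_add.
rewrite !integral_measure_add//; try exact: integrable_measure_add.
have RE (m : measure (R * R)%type R) (g : R * R -> R) :
    m.-integrable setT (EFin \o g) ->
    (\int[m]_x (g x)%:E)%E = (\int[m]_x g x)%:E.
  by move=> ig; rewrite /Rintegral fineK//; exact: integrable_fin_num.
rewrite !intpE !RE//; try exact: intfd.
by rewrite -!EFinD => -[<-]; ring.
Qed.

(* The frequency [A^-1 xi]. *)
Definition scaleA xi : R * R := (xi.1 / (3 * q1)%:R, xi.2 / (3 * q2)%:R).

Lemma dotR2_contraction xi d x :
  dotR2 xi (contraction d x) = dotR2 (scaleA xi) x + dotR2 (scaleA xi) d.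
Proof. by rewrite /dotR2 /scaleA /contraction/=; ring. Qed.

Lemma Rintegral_cos_shift xi t :
  \int[mu]_x cos (2 * pi * (dotR2 xi x + t)) =
  cos (2 * pi * t) * fourier_cos xi - sin (2 * pi * t) * fourier_sin xi.
Proof.
under eq_Rintegral do rewrite [_ + t]addrC mulrDr cosD.
have ic := integrable_cos_dot xi; have isn := integrable_sin_dot xi.
rewrite RintegralB//; first by rewrite !RintegralZl.
  exact: (integrableZl measurableT _ ic).
exact: (integrableZl measurableT _ isn).
Qed.

Lemma Rintegral_sin_shift xi t :
  \int[mu]_x sin (2 * pi * (dotR2 xi x + t)) =
  sin (2 * pi * t) * fourier_cos xi + cos (2 * pi * t) * fourier_sin xi.
Proof.
under eq_Rintegral do rewrite [_ + t]addrC mulrDr sinD.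
have ic := integrable_cos_dot xi; have isn := integrable_sin_dot xi.
rewrite RintegralD//; first by rewrite !RintegralZl.
  exact: (integrableZl measurableT _ ic).
exact: (integrableZl measurableT _ isn).
Qed.

(** Each shift by a digit multiplies the transform at [eta] by one term of the mask. Squared moduli
    are multiplicative, and 9 is the square of the 3 in [invariant_Rintegral]. *)
Lemma fourier_sqnorm_scale xi : let eta := scaleA xi in
  9 * fourier_sqnorm xi =
  (mask_re eta.1 eta.2 ^+ 2 + mask_im eta.1 eta.2 ^+ 2) * fourier_sqnorm eta.
Proof.
move=> eta.
have dot00 : dotR2 eta (0, 0) = 0 by rewrite /dotR2 !mulr0 addr0.
have dot10 : dotR2 eta (1, 0) = eta.1 by rewrite /dotR2 mulr0 mulr1 addr0.
have dot01 : dotR2 eta (0, 1) = eta.2 by rewrite /dotR2 mulr0 mulr1 add0r.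
have hc := invariant_Rintegral (measurable_cos_dot xi) (fun x => cos_max _).
have hs := invariant_Rintegral (measurable_sin_dot xi) (fun x => sin_max _).
have shc d : \int[mu]_x cos (2 * pi * dotR2 xi (contraction d x)) =
    \int[mu]_x cos (2 * pi * (dotR2 eta x + dotR2 eta d)).
  by apply: eq_Rintegral => x _; rewrite dotR2_contraction.
have shs d : \int[mu]_x sin (2 * pi * dotR2 xi (contraction d x)) =
    \int[mu]_x sin (2 * pi * (dotR2 eta x + dotR2 eta d)).
  by apply: eq_Rintegral => x _; rewrite dotR2_contraction.
move: hc hs; rewrite -/(fourier_cos xi) -/(fourier_sin xi).
rewrite !shc !shs !Rintegral_cos_shift !Rintegral_sin_shift dot00 dot10 dot01.
rewrite mulr0 cos0 sin0 /mask_re /mask_im /fourier_sqnorm => hc hs.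
have -> : 9 * (fourier_cos xi ^+ 2 + fourier_sin xi ^+ 2) =
  (3 * fourier_cos xi) ^+ 2 + (3 * fourier_sin xi) ^+ 2 by ring.
by rewrite hc hs; ring.
Qed.

Lemma iter_scaleA n xi :
  iter n scaleA xi = (xi.1 / (3 * q1)%:R ^+ n, xi.2 / (3 * q2)%:R ^+ n).
Proof.
elim: n => [|n IHn]; first by rewrite !expr0 !divr1; case: xi.
by rewrite iterS IHn /scaleA/= !exprSr !invfM !mulrA.
Qed.

Lemma cvg_div_expr (a : R) (b : nat) : (1 < b)%N ->
  a / b%:R ^+ n @[n --> \oo] --> 0.
Proof.
move=> b1; rewrite -(mulr0 a).
under eq_fun do rewrite -exprVn.
apply: cvgM; first exact: cvg_cst.
apply: cvg_expr; rewrite ger0_norm ?invr_ge0//.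
by rewrite invf_lt1 ?ltr0n ?ltr1n; lia.
Qed.

(** If the mask vanished at no iterate, the zero at [xi] would pass to every iterate, against the
    limit 1 at the origin. Conversely, a zero at an iterate climbs back to [xi]. *)
Lemma fourier_sqnorm_eq0 xi : fourier_sqnorm xi = 0 <->
  exists n, let eta := iter n.+1 scaleA xi in
    mask_re eta.1 eta.2 = 0 /\ mask_im eta.1 eta.2 = 0.
Proof.
split=> [xi0|[n [hr hi]]].
  apply: contrapT => nex.
  have F0 n : fourier_sqnorm (iter n scaleA xi) = 0.
    elim: n => [//|n IHn]; have := fourier_sqnorm_scale (iter n scaleA xi).
    rewrite IHn mulr0 => /esym/eqP; rewrite mulf_eq0 => /orP[|/eqP //].
    rewrite paddr_eq0 ?sqr_ge0// !sqrf_eq0 => /andP[/eqP hr /eqP hi].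
    by exfalso; apply: nex; exists n.
  have C0 n : fourier_cos (iter n scaleA xi) = 0.
    have /eqP := F0 n; rewrite paddr_eq0 ?sqr_ge0// !sqrf_eq0.
    by move=> /andP[/eqP].
  have : fourier_cos (iter n scaleA xi) @[n --> \oo] --> (1 : R).
    apply: fourier_cos_cvg1; under eq_fun do rewrite iter_scaleA/=.
      by apply: cvg_div_expr; lia.
    by apply: cvg_div_expr; lia.
  under eq_fun do rewrite C0.
  move=> /(cvg_unique _ (cvg_cst (0 : R))) => h01.
  by have := oner_neq0 R; rewrite -h01// eqxx.
have main (m : nat) z : fourier_sqnorm (iter m scaleA z) = 0 ->
    fourier_sqnorm z = 0.
  elim: m z => [//|m IHm] z; rewrite iterSr => /IHm h.
  have /eqP := fourier_sqnorm_scale z; rewrite h mulr0 mulf_eq0 pnatr_eq0/=.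
  by move/eqP.
apply: (main n).
have /eqP := fourier_sqnorm_scale (iter n scaleA xi).
rewrite -iterS hr hi expr0n addr0 mul0r mulf_eq0 pnatr_eq0/=.
by move/eqP.
Qed.

End FourierTransform.

(** * Residues modulo 3 and centred digits *)

Lemma intr_pair (t : int) : t%:~R = (t, t) :> (int * int)%type.
Proof.
have nat_pair n : n%:R = (n%:Z, n%:Z) :> (int * int)%type.
  by elim: n => // n IHn; rewrite -natr1 IHn; congr pair => /=; lia.
by case: t => n; rewrite ?NegzE ?mulrNz -pmulrn nat_pair.
Qed.

Lemma digit_mod3 (t : int) : exists i, (3 %| digit i - t)%Z.
Proof.
have h : (0 <= (t + 1) %% 3 < 3)%Z by rewrite modz_ge0//= ltz_pmod.
have lt3 : (`|(t + 1) %% 3|%Z < 3)%N by lia.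
exists (Ordinal lt3); rewrite /digit/=; lia.
Qed.

Lemma digit_inj3 (i j : 'I_3) : (3 %| digit i - digit j)%Z -> i = j.
Proof.
rewrite /digit => h; apply: val_inj => /=.
have := ltn_ord i; have := ltn_ord j; lia.
Qed.

Lemma centered_mod (b : nat) (x : int) : (0 < b)%N ->
  exists m : int, - b%:Z <= 2 * (x - b%:Z * m) < b%:Z.
Proof.
move=> b0; exists ((2 * x + b%:Z) %/ (2 * b%:Z))%Z.
have := divz_eq (2 * x + b%:Z) (2 * b%:Z).
have := modz_ge0 (2 * x + b%:Z) (_ : 2 * b%:Z != 0).
have := ltz_pmod (2 * x + b%:Z) (_ : 0 < 2 * b%:Z).
set d := (_ %/ _)%Z; set r := (_ %% _)%Z => h1 h2 h3.
have {}h1 : r < 2 * b%:Z by apply: h1; lia.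
have {}h2 : 0 <= r by apply: h2; lia.
nia.
Qed.

Lemma small_multiple (b : nat) (d a : int) :
  - b%:Z < d < b%:Z -> d = b%:Z * a -> d = 0.
Proof.
move=> hd h; have [a0|a0|a0] := ltgtP a 0; [nia|nia|].
by rewrite h a0 mulr0.
Qed.

(** Here [r n] is what remains of an integer after removing n centred digits [g] in base b. A
    nonzero remainder shrinks strictly, since |r|/b + 1/2 < |r| once b is at least 3, and a zero
    remainder stays zero. *)
Lemma quotients_vanish (b : int) (g r : nat -> int) : 3 <= b ->
  (forall n, - b <= 2 * g n <= b) -> (forall n, r n = g n + b * r n.+1) ->
  exists N, forall n, (N <= n)%N -> r n = 0.
Proof.
move=> b3.
have [m] := ubnP `|r 0%N|%N; elim: m g r => [//|m IHm] g r rm hg hr.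
have [r0|r0] := eqVneq (r 0%N) 0.
  exists 0%N => n _; elim: n => [//|n rn].
  by have := hg n; have := hr n; rewrite rn; nia.
have r1 : (`|r 1%N| < `|r 0%N|)%N.
  by have := hg 0%N; have := hr 0%N; nia.
have [|n|n|N hN] := IHm (g \o succn) (r \o succn); first by rewrite /=; lia.
- exact: hg.
- exact: hr.
by exists N.+1 => -[//|n] hn; exact: hN.
Qed.

Lemma prefixS (w : nat -> 'I_3) n : Defs.prefix w n.+1 = rcons (Defs.prefix w n) (w n).
Proof. exact: mkseqS. Qed.

Lemma size_prefix (w : nat -> 'I_3) n : size (Defs.prefix w n) = n.
Proof. exact: size_mkseq. Qed.

(** * Congruences modulo powers of the matrix *)

Section Lattice.
Variables q1 q2 : nat.
Hypotheses (q1_gt0 : (0 < q1)%N) (q2_gt0 : (0 < q2)%N).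
Notation Z2 := (int * int)%type.
Implicit Types (x y z e : Z2) (I J : seq 'I_3) (k n : nat).

(* [int * int] carries the componentwise ring structure, in which the diagonal
   matrix [A] acts as multiplication by [matA]. *)
Definition matA : Z2 := ((3 * q1)%:Z, (3 * q2)%:Z).
Definition vecq : Z2 := (q1%:Z, - q2%:Z).

Definition modA k x y := exists m : Z2, x - y = matA ^+ k * m.

Lemma modA_refl k x : modA k x x.
Proof. by exists 0; ring. Qed.

Lemma modA_sym k x y : modA k x y -> modA k y x.
Proof. by case=> m h; exists (- m); rewrite mulrN -h; ring. Qed.

Lemma modA_trans k y x z : modA k x y -> modA k y z -> modA k x z.
Proof.
by move=> [m h] [p g]; exists (m + p); rewrite mulrDr -h -g; ring.
Qed.

Lemma modA_leq k n x y : (n <= k)%N -> modA k x y -> modA n x y.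
Proof.
move=> nk [m h]; exists (matA ^+ (k - n) * m).
by rewrite h mulrA -exprD subnKC.
Qed.

Lemma modA_shift k x y : modA 1 x y ->
  forall u, modA k.+1 (u + matA ^+ k * x) (u + matA ^+ k * y).
Proof.
move=> [m h] u; exists m; rewrite exprSr -mulrA -[matA]expr1 -h.
by ring.
Qed.

(** The ring [int * int] has zero divisors; cancellation is possible because both coordinates of
    [matA] are nonzero. *)
Lemma matA_mulI k x y : matA ^+ k * x = matA ^+ k * y -> x = y.
Proof.
elim: k x y => [|k IHk] x y; first by rewrite !mul1r.
rewrite exprS -!mulrA => h; apply: IHk.
move: (matA ^+ k * x) (matA ^+ k * y) h => [a b] [c d] [] /=.
by move=> h1 h2; congr pair; nia.
Qed.

Lemma congAP x y : congA q1 q2 x y <-> modA 1 x y.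
Proof.
split=> [[/dvdzP[a ha] /dvdzP[b hb]]|[[a b] h]].
  exists (a, b); rewrite expr1; case: x y ha hb => [x1 x2] [y1 y2]/= ha hb.
  by congr pair => /=; rewrite mulrC.
have [h1 h2] : x.1 - y.1 = (3 * q1)%:Z * a /\ x.2 - y.2 = (3 * q2)%:Z * b.
  by move: h; case: x y => [x1 x2] [y1 y2]; rewrite expr1 => -[/= -> ->].
by split; apply/dvdzP; [exists a; rewrite h1|exists b; rewrite h2]; rewrite mulrC.
Qed.

Lemma vqE i : vq q1 q2 i = vecq * (digit i)%:~R.
Proof. by rewrite intr_pair; congr pair => /=; lia. Qed.

(** The vector 3 v equals A (1, -1), so multiples of v modulo A only depend on the factor modulo
    3. *)
Lemma vecq_mod3 (s t : int) : (3 %| s - t)%Z ->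
  modA 1 (vecq * s%:~R) (vecq * t%:~R).
Proof.
move=> /dvdzP[m h]; exists (m, - m).
by rewrite -mulrBr -intrB h expr1 intr_pair; congr pair => /=; lia.
Qed.

Lemma vecq_modA_dvd3 (t : int) : modA 1 (vecq * t%:~R) 0 -> (3 %| t)%Z.
Proof.
move=> [[a b]]; rewrite subr0 intr_pair expr1 => -[h1 _]; apply/dvdzP; exists a.
move: h1; rewrite PoszM => h1; nia.
Qed.

(** Lattice form of the condition that A^-(k+1) w is a zero of the mask, since A^-1 v = (1/3,
    -1/3). *)
Definition orth_level k (w : Z2) :=
  exists t : int, ~~ (3 %| t)%Z /\ modA k.+1 w (matA ^+ k * (vecq * t%:~R)).

Definition orth_diff (w : Z2) := exists k, orth_level k w.

Lemma orth_diffN w : orth_diff w -> orth_diff (- w).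
Proof.
move=> [k [t [t3 [m h]]]]; exists k, (- t); split; first by lia.
exists (- m); rewrite mulrN -h mulrNz; ring.
Qed.

(* A nonzero difference [A^j (t v + A m)] with [3] not dividing [t] determines
   [j]: it is divisible by [A^j] but not by [A^(j+1)]. *)
Lemma orth_diff_modA k (w : Z2) : w = 0 \/ orth_diff w -> modA k w 0 ->
  exists t : int, modA k.+1 w (matA ^+ k * (vecq * t%:~R)).
Proof.
move=> [->|[j [t [t3 ht]]]] hk.
  by exists 0; rewrite mulr0 mulr0; exact: modA_refl.
have [jk|kj|jk] := ltngtP j k; last by exists t; rewrite -jk.
  exfalso; move/negP: t3; apply; apply: vecq_modA_dvd3.
  have [m h] := modA_trans (modA_sym ht) (modA_leq jk hk).
  exists m; apply: (@matA_mulI j).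
  by rewrite subr0 expr1 [RHS]mulrA -exprSr -h subr0.
exists 0; rewrite !mulr0; case: ht => m h.
apply: (modA_leq kj); exists (vecq * t%:~R + matA * m).
by rewrite subr0 mulrDr [X in _ = _ + X]mulrA -exprSr -h; ring.
Qed.

Lemma exists_Gamma x : exists y, in_Gamma q1 q2 y /\ modA 1 y x.
Proof.
have [a ha] := @centered_mod (3 * q1) x.1 ltac:(lia).
have [b hb] := @centered_mod (3 * q2) x.2 ltac:(lia).
exists (x.1 - (3 * q1)%:Z * a, x.2 - (3 * q2)%:Z * b); split.
  by rewrite /in_Gamma/=; lia.
exists (- a, - b); rewrite expr1; case: x {ha hb} => x1 x2.
by congr pair => /=; ring.
Qed.

Lemma Gamma_inj x y : in_Gamma q1 q2 x -> in_Gamma q1 q2 y ->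
  modA 1 x y -> x = y.
Proof.
case: x y => [x1 x2] [y1 y2]; rewrite /in_Gamma/= => hx hy [[a b]].
rewrite expr1 => -[/= h1 h2]; congr pair; apply/eqP; rewrite -subr_eq0; apply/eqP.
  by apply: (small_multiple _ h1); lia.
by apply: (small_multiple _ h2); lia.
Qed.

(** A multiple of v brings the first coordinate into its window of length q1; the second is then
    reduced modulo 3 q2, which leaves the first unchanged. *)
Lemma exists_E x : exists e (t : int),
  in_E q1 q2 e /\ modA 1 x (e + vecq * t%:~R).
Proof.
have [t ht] := @centered_mod q1 x.1 q1_gt0.
have [b hb] := @centered_mod (3 * q2) (x.2 + q2%:Z * t) ltac:(lia).
exists (x.1 - q1%:Z * t, x.2 + q2%:Z * t - (3 * q2)%:Z * b), t; split.
  by rewrite /in_E /in_Gamma/=; lia.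
exists (0, b); rewrite expr1 intr_pair; case: x {ht hb} => x1 x2.
by congr pair => /=; ring.
Qed.

(** For a digit 1 or -1, the first coordinate of the sum has absolute value between q1/2 and 3 q1/2,
    so it is not a multiple of 3 q1. Along a path where [tau] vanishes, the letters must therefore
    be zero. *)
Lemma in_E_digit0 e i : in_E q1 q2 e ->
  modA 1 0 (e + vecq * (digit i)%:~R) -> i = zero3.
Proof.
case: e => [e1 e2]; rewrite /in_E/= => -[_ he] [[a b]].
rewrite expr1 intr_pair => -[/= h1 _].
case: i h1 => -[|[|[|//]]] /= i3 h1; [exfalso| exact: val_inj|exfalso];
  have := small_multiple _ h1; rewrite /digit/=; lia.
Qed.

Lemma vq_in_Gamma i : in_Gamma q1 q2 (vq q1 q2 i).
Proof.
rewrite /in_Gamma /vq /digit/=; case: i => -[|[|[|//]]] /= _; lia.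
Qed.

Lemma zero_in_E : in_E q1 q2 0.
Proof. by rewrite /in_E /in_Gamma/=; lia. Qed.

(** * Values of words and paths in the digit tree *)

Definition word_value (tau : seq 'I_3 -> Z2) I : Z2 :=
  \sum_(k < size I) matA ^+ k * tau (take k.+1 I).

Lemma word_value_nil tau : word_value tau [::] = 0.
Proof. by rewrite /word_value big_ord0. Qed.

Lemma word_value_rcons tau I j : word_value tau (rcons I j) =
  word_value tau I + matA ^+ size I * tau (rcons I j).
Proof.
rewrite /word_value size_rcons big_ord_recr/= [take (size I).+1 _]take_oversize ?size_rcons//.
congr (_ + _); apply: eq_bigr => k _.
by rewrite -cats1 takel_cat// ltn_ord.
Qed.

Lemma word_value_prefixS tau (w : nat -> 'I_3) n :
  word_value tau (Defs.prefix w n.+1) =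
  word_value tau (Defs.prefix w n) + matA ^+ n * tau (Defs.prefix w n.+1).
Proof. by rewrite prefixS word_value_rcons size_prefix. Qed.

Lemma matA_expr k : matA ^+ k = (((3 * q1) ^ k)%:Z, ((3 * q2) ^ k)%:Z).
Proof.
by elim: k => [//|k IHk]; rewrite exprS IHk !expnS; congr pair => /=;
  rewrite PoszM.
Qed.

Lemma tau_partialE tau w n :
  tau_partial q1 q2 tau w n = word_value tau (Defs.prefix w n).
Proof.
elim: n => [|n IHn]; first by rewrite /tau_partial word_value_nil !big_ord0.
rewrite word_value_prefixS -IHn /tau_partial !big_ord_recr/= matA_expr.
by [].
Qed.

Lemma word_value_modA tau w n k : (k <= n)%N ->
  modA k (word_value tau (Defs.prefix w n)) (word_value tau (Defs.prefix w k)).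
Proof.
elim: n => [|n IHn]; first by rewrite leqn0 => /eqP ->; exact: modA_refl.
rewrite leq_eqVlt ltnS => /orP[/eqP ->|kn]; first exact: modA_refl.
apply: modA_trans (IHn kn); apply: (modA_leq kn).
by exists (tau (Defs.prefix w n.+1)); rewrite word_value_prefixS; ring.
Qed.

(** Condition (ii) asked of every word, the empty and zero words included; for these, condition (i)
    provides it with e = 0. *)
Definition branching (tau : seq 'I_3 -> Z2) := forall I,
  exists e, in_E q1 q2 e /\
    forall j, modA 1 (tau (rcons I j)) (e + vecq * (digit j)%:~R).

Definition Gamma_valued (tau : seq 'I_3 -> Z2) :=
  forall I j, in_Gamma q1 q2 (tau (rcons I j)).

Definition tree_set (tau : seq 'I_3 -> Z2) (z : Z2) :=
  exists (w : nat -> 'I_3) (N : nat), forall n, (N <= n)%N ->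
    tau (Defs.prefix w n) = 0 /\ word_value tau (Defs.prefix w n) = z.

(** Both x and y pass through the node [I], so orthogonality makes their next digits differ by some
    t v. As y takes the child j, x takes the child congruent to j + t modulo 3. *)
Lemma tree_step tau I j x y : branching tau ->
  modA (size I) x (word_value tau I) ->
  modA (size I).+1 y (word_value tau (rcons I j)) ->
  x - y = 0 \/ orth_diff (x - y) ->
  exists i, modA (size I).+1 x (word_value tau (rcons I i)).
Proof.
move=> /(_ I)[e [_ he]] xI yI xy.
have yI' : modA (size I) y (word_value tau I).
  apply: (modA_trans (modA_leq (leqnSn _) yI)).
  by exists (tau (rcons I j)); rewrite word_value_rcons; ring.
have [m hm] := modA_trans xI (modA_sym yI').
have [|t ht] := orth_diff_modA xy (k := size I).
  by exists m; rewrite subr0.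
have [i hi] := digit_mod3 (digit j + t).
exists i.
have {}ht : modA (size I).+1 x (y + matA ^+ size I * (vecq * t%:~R)).
  by case: ht => p hp; exists p; rewrite -hp; ring.
apply: modA_trans ht _.
have {}yI : modA (size I).+1 (y + matA ^+ size I * (vecq * t%:~R))
    (word_value tau (rcons I j) + matA ^+ size I * (vecq * t%:~R)).
  by case: yI => p hp; exists p; rewrite -hp; ring.
apply: modA_trans yI _; rewrite !word_value_rcons -addrA -mulrDr.
apply: modA_shift.
apply: (@modA_trans _ (e + vecq * (digit j + t)%:~R)).
  by case: (he j) => p hp; exists p; rewrite -hp intrD; ring.
apply: (@modA_trans _ (e + vecq * (digit i)%:~R)); last exact/modA_sym/he.
have [p hp] := vecq_mod3 hi.
by exists (- p); rewrite mulrN -hp; ring.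
Qed.

Lemma tree_path tau x I :
  (forall I, modA (size I) x (word_value tau I) ->
    exists i, modA (size I).+1 x (word_value tau (rcons I i))) ->
  modA (size I) x (word_value tau I) ->
  exists w, Defs.prefix w (size I) = I /\
    forall n, modA n x (word_value tau (Defs.prefix w n)).
Proof.
move=> step xI.
(* The step is made total, with an arbitrary letter off the path, so that choice yields a successor
   function on all words. *)
have {}step J : exists i, modA (size J) x (word_value tau J) ->
    modA (size J).+1 x (word_value tau (rcons J i)).
  have [/step[i hi]|nJ] := pselect (modA (size J) x (word_value tau J)).
    by exists i.
  by exists zero3.
have [nxt hnxt] := boolp.choice step.
pose W n := iter n (fun J => rcons J (nxt J)) I.
have WS n : W n.+1 = rcons (W n) (nxt (W n)) by [].
have sW n : size (W n) = (size I + n)%N.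
  by elim: n => [|n IHn]; rewrite ?addn0// WS size_rcons IHn addnS.
have stable n p k : (k < size (W n))%N ->
    nth zero3 (W (n + p)%N) k = nth zero3 (W n) k.
  move=> kn; elim: p => [|p IHp]; first by rewrite addn0.
  rewrite addnS WS nth_rcons IHp.
  by have -> : (k < size (W (n + p)))%N by move: kn; rewrite !sW; lia.
(* The word [W k.+1] is long enough to have a letter at position k, and later words keep it. *)
pose w k := nth zero3 (W k.+1) k.
have prefW n : Defs.prefix w (size I + n)%N = W n.
  apply: (@eq_from_nth _ zero3); rewrite ?size_prefix ?sW// => k kn.
  rewrite nth_mkseq// /w.
  have k1 : (k < size (W k.+1))%N by rewrite sW; lia.
  have k2 : (k < size (W n))%N by rewrite sW.
  by rewrite -(stable _ n _ k1) -(stable _ k.+1 _ k2) addnC.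
have modW n : modA (size I + n) x (word_value tau (W n)).
  elim: n => [|n IHn]; first by rewrite addn0.
  by rewrite addnS WS -sW; apply: hnxt; rewrite sW.
exists w; split; first by have := prefW 0%N; rewrite addn0.
move=> n; have := modW n; rewrite -prefW => h.
apply: (modA_trans (modA_leq (leq_addl _ _) h)).
by apply: word_value_modA; exact: leq_addl.
Qed.

(** The quotients [r n] of x minus the partial value by A^n satisfy the digit recursion in each
    coordinate, with digits centred by [in_Gamma], so [quotients_vanish] ends the expansion. *)
Lemma tree_limit tau w x : Gamma_valued tau ->
  (forall n, modA n x (word_value tau (Defs.prefix w n))) ->
  exists N, forall n, (N <= n)%N ->
    tau (Defs.prefix w n) = 0 /\ word_value tau (Defs.prefix w n) = x.
Proof.
move=> tauG /boolp.choice[r hr].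
pose g n := tau (Defs.prefix w n.+1).
have gG n : in_Gamma q1 q2 (g n) by rewrite /g prefixS; exact: tauG.
have rE n : r n = g n + matA * r n.+1.
  apply: (@matA_mulI n); rewrite mulrDr [X in _ + X]mulrA -exprSr -!hr.
  by rewrite word_value_prefixS /g; ring.
have [|n|n|N1 h1] := @quotients_vanish (3 * q1)%:Z (fst \o g) (fst \o r).
- by lia.
- by have := gG n; rewrite /in_Gamma/=; lia.
- by rewrite /= {1}rE.
have [|n|n|N2 h2] := @quotients_vanish (3 * q2)%:Z (snd \o g) (snd \o r).
- by lia.
- by have := gG n; rewrite /in_Gamma/=; lia.
- by rewrite /= {1}rE.
have r0 n : (N1 + N2 <= n)%N -> r n = 0.
  move=> hn; rewrite [r n]surjective_pairing.
  by congr pair; [apply: h1|apply: h2]; lia.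
exists (N1 + N2).+1 => -[//|n]; rewrite ltnS => hn; split.
  by have := rE n; rewrite !r0 ?mulr0 ?addr0//; lia.
have := hr n.+1; rewrite r0 ?mulr0; last by lia.
by move/eqP; rewrite subr_eq0 => /eqP.
Qed.

Lemma tree_set_modA tau w N z : (forall n, (N <= n)%N ->
    tau (Defs.prefix w n) = 0 /\ word_value tau (Defs.prefix w n) = z) ->
  forall k, modA k z (word_value tau (Defs.prefix w k)).
Proof.
move=> hw k; have [_ <-] := hw (N + k)%N (leq_addr _ _).
by apply: word_value_modA; exact: leq_addl.
Qed.

(* At the first letter where the two words differ, branching makes the digits
   differ by a multiple of [vecq] not divisible by [3]. *)
Lemma tree_set_orth tau x y : branching tau ->
  tree_set tau x -> tree_set tau y -> x <> y -> orth_diff (x - y).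
Proof.
move=> tauB [w [N hw]] [w' [N' hw']] xy.
have [k wk] : exists k, w k != w' k.
  apply: contrapT => ww; apply: xy.
  have [_ <-] := hw (N + N')%N (leq_addr _ _).
  have [_ <-] := hw' (N + N')%N (leq_addl _ _).
  congr (word_value tau _); apply: eq_mkseq => k.
  by apply/eqP/negPn/negP => wk; apply: ww; exists k.
case: (ex_minnP (ex_intro (fun k => w k != w' k) k wk)) => {wk}k wk kmin.
have pk : Defs.prefix w' k = Defs.prefix w k.
  apply: (@eq_from_nth _ zero3); rewrite ?size_prefix// => i ik.
  rewrite !nth_mkseq//; apply/eqP/negPn/negP => wi.
  by have := kmin i; rewrite eq_sym wi => /(_ isT); lia.
have xk := tree_set_modA hw k.+1; have yk := tree_set_modA hw' k.+1.
move: xk yk; rewrite !word_value_prefixS !prefixS pk.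
have [e [_ he]] := tauB (Defs.prefix w k) => xk yk.
exists k, (digit (w k) - digit (w' k)); split.
  by apply/negP => /digit_inj3/eqP; apply/negP.
have [a ha] := modA_trans xk (modA_shift k (he (w k)) _).
have [b hb] := modA_trans yk (modA_shift k (he (w' k)) _).
by exists (a - b); rewrite mulrBr -ha -hb intrB; ring.
Qed.

(** The witness attached to a child of [I] feeds [tree_step], so x descends from the root through
    every level; any child would serve. *)
Lemma tree_set_complete tau x : branching tau -> Gamma_valued tau ->
  (forall I, exists y, modA (size I) y (word_value tau I) /\
    (x - y = 0 \/ orth_diff (x - y))) -> tree_set tau x.
Proof.
move=> tauB tauG hx.
have [I xI||w [_ hw]] := @tree_path tau x [::].
- have [y []] := hx (rcons I zero3); rewrite size_rcons => yI xy.
  exact: (tree_step tauB xI yI xy).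
- by rewrite word_value_nil; exists x; rewrite mul1r subr0.
by exists w; exact: tree_limit.
Qed.

(** * From a tree mapping to maximality *)

Section FromTreeMapping.
Variable tau : seq 'I_3 -> Z2.
Hypothesis tauM : maximal_tree_mapping q1 q2 tau.

Lemma tree_mapping_Gamma : Gamma_valued tau.
Proof. by case: tauM => h _ I j; apply: h; rewrite size_rcons. Qed.

Lemma tree_mapping_branching : branching tau.
Proof.
case: tauM => _ [h0 [h1 _]] I.
have [->|In0] := pselect (I = nseq (size I) zero3).
  exists 0; split; first exact: zero_in_E.
  by move=> j; rewrite -cats1 h0 vqE add0r; exact: modA_refl.
have [|e [eE he]] := h1 I _ In0; first by case: I In0.
by exists e; split=> // j; have /congAP := he j; rewrite !vqE.
Qed.

Lemma tree_mapping_dense I : (0 < size I)%N ->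
  exists z, tree_set tau z /\ modA (size I) z (word_value tau I).
Proof.
move=> I0; case: tauM => _ [_ [_ /(_ I I0)[J [_ [N hN]]]]].
(* The default value of [nth] supplies the infinite tail of zeros. *)
pose w n := nth zero3 (I ++ J) n; pose K := size (I ++ J).
have prefK n : Defs.prefix w (K + n)%N = I ++ J ++ nseq n zero3.
  apply: (@eq_from_nth _ zero3) => [|i]; rewrite size_prefix.
    by rewrite catA size_cat size_nseq.
  move=> iK; rewrite nth_mkseq// catA nth_cat -/K nth_nseq /w.
  by case: ltnP => // Ki; rewrite if_same nth_default.
have prefI : Defs.prefix w (size I) = I.
  apply: (@eq_from_nth _ zero3) => [|i]; rewrite size_prefix// => iI.
  by rewrite nth_mkseq// /w nth_cat iI.
have tau0 n : (K + N <= n)%N -> tau (Defs.prefix w n) = 0.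
  move=> hn; have -> : n = (K + (n - K))%N by lia.
  by rewrite prefK hN//; lia.
pose z := word_value tau (Defs.prefix w (K + N)).
have zE n : word_value tau (Defs.prefix w (K + N + n)) = z.
  elim: n => [|n IHn]; first by rewrite addn0.
  by rewrite addnS word_value_prefixS IHn tau0 ?mulr0 ?addr0//; lia.
exists z; split.
  exists w, (K + N)%N => n hn; split; first exact: tau0.
  by have -> : n = (K + N + (n - (K + N)))%N by lia; exact: zE.
rewrite -[in X in modA _ _ X]prefI; apply: word_value_modA.
by rewrite /K size_cat; lia.
Qed.

Lemma tree_mapping_maximal x :
  (forall y, tree_set tau y -> x - y = 0 \/ orth_diff (x - y)) ->
  tree_set tau x.
Proof.
move=> hx; apply: tree_set_complete.
- exact: tree_mapping_branching.
- exact: tree_mapping_Gamma.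
move=> I; have [|y [yT]] := @tree_mapping_dense (rcons I zero3).
  by rewrite size_rcons.
rewrite size_rcons => yI; exists y; split; last exact: hx.
apply: (modA_trans (modA_leq (leqnSn _) yI)).
by exists (tau (rcons I zero3)); rewrite word_value_rcons; ring.
Qed.

End FromTreeMapping.

(** * From a maximal set to a tree mapping *)

Section ToTreeMapping.
Variable M : Z2 -> Prop.
Hypothesis M0 : M 0.
Hypothesis M_orth : forall x y, M x -> M y -> x - y = 0 \/ orth_diff (x - y).
Hypothesis M_max : forall x,
  (forall y, M y -> x - y = 0 \/ orth_diff (x - y)) -> M x.

(* If no element of [M] lies in the class of [x + t A^k v] modulo [A^(k+1)],
   then [x + t A^k v] itself can be added to [M]. *)
Lemma maximal_full x k (t : int) : M x ->
  exists y, M y /\ modA k.+1 y (x + matA ^+ k * (vecq * t%:~R)).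
Proof.
move=> Mx; apply: contrapT => nex.
pose x' := x + matA ^+ k * (vecq * t%:~R).
suff Mx' : M x' by apply: nex; exists x'; split=> //; exact: modA_refl.
apply: M_max => y My; right.
have x'yE : x' - y = (x - y) + matA ^+ k * (vecq * t%:~R) by rewrite /x'; ring.
(* Either x and y separate at a level j < k, which the shift leaves untouched, or they agree modulo
   A^k and differ there by some s v, which the shift turns into (s + t) v. *)
have [[j [s [jk s3 xys]]]|[s [m hm]]] : (exists j (s : int), [/\ (j < k)%N,
    ~~ (3 %| s)%Z & modA j.+1 (x - y) (matA ^+ j * (vecq * s%:~R))]) \/
    exists s : int, modA k.+1 (x - y) (matA ^+ k * (vecq * s%:~R)).
- have := M_orth Mx My => /[dup] xy -[xy0|[j [s [s3 xys]]]].
    by right; exists 0; rewrite xy0 !mulr0; exact: modA_refl.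
  have [jk|kj] := ltnP j k; first by left; exists j, s.
  right; apply: (orth_diff_modA xy); apply: (modA_leq kj); case: xys => m hm.
  exists (vecq * s%:~R + matA * m).
  by rewrite subr0 mulrDr [X in _ = _ + X]mulrA -exprSr -hm; ring.
- exists j, s; split=> //; apply: modA_trans _ xys; apply: (modA_leq jk).
  by apply: (@modA_leq k); [|exists (vecq * t%:~R); rewrite x'yE; ring].
exists k, (s + t); split; last by exists m; rewrite -hm x'yE intrD; ring.
apply/negP => st3; apply: nex; exists y; split=> //.
have [p hp] : modA k.+1 (0 + matA ^+ k * (vecq * 0%:~R))
    (0 + matA ^+ k * (vecq * (s + t)%:~R)).
  by apply: modA_shift; apply: vecq_mod3; lia.
by exists (p - m); rewrite mulrBr -hm -hp intrD; ring.
Qed.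

(** For a node of value u at depth k met by some x in [M], the base is the representative in E of
    the quotient of x - u by A^k. At u = 0 it is pinned to 0, as condition (i) requires, and 0 in
    [M] is the witness. *)
Lemma exists_branch_base : exists e : Z2 * nat -> Z2, (forall k, e (0, k) = 0) /\
  forall u k, in_E q1 q2 (e (u, k)) /\ ((exists2 x, M x & modA k x u) ->
    exists x (t : int), M x /\
      modA k.+1 x (u + matA ^+ k * (e (u, k) + vecq * t%:~R))).
Proof.
have H (p : Z2 * nat) : exists e, (p.1 = 0 -> e = 0) /\ (in_E q1 q2 e /\
    ((exists2 x, M x & modA p.2 x p.1) -> exists x (t : int), M x /\
      modA p.2.+1 x (p.1 + matA ^+ p.2 * (e + vecq * t%:~R)))).
  case: p => u k /=.
  have [->|u0] := eqVneq u 0.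
    exists 0; split=> //; split; first exact: zero_in_E.
    by move=> _; exists 0, 0; split=> //; exists 0; ring.
  have [[x Mx [m hm]]|nx] := pselect (exists2 x, M x & modA k x u).
    have [e [t [eE [p hp]]]] := exists_E m.
    exists e; split; first by move/eqP; rewrite (negPf u0).
    split=> // _; exists x, t; split=> //; exists p.
    rewrite exprSr -mulrA -[matA]expr1 -hp mulrBr -hm; ring.
  by exists 0; split=> //; split; first exact: zero_in_E.
have [e he] := boolp.choice H.
by exists e; split=> [k|u k]; [apply: (he (0, k)).1|exact: (he (u, k)).2].
Qed.

(** The digits are the representatives in Gamma of e + j v. Fullness of [M] puts an element in every
    node; its path has a finite expansion and ends in zero letters, which gives condition (iii). *)
Lemma exists_tree_mapping : exists tau, maximal_tree_mapping q1 q2 tau /\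
  (forall x, M x <-> tree_set tau x).
Proof.
have [e [e0 he]] := exists_branch_base.
have [dig hdig] := boolp.choice exists_Gamma.
(* The recursion runs on the reversed word, whose head is the last letter. *)
pose fix U (s : seq 'I_3) : Z2 := if s is j :: s' then
  U s' + matA ^+ size s' * dig (e (U s', size s') + vecq * (digit j)%:~R) else 0.
pose tau I : Z2 := if rev I is j :: s then
  dig (e (U s, size s) + vecq * (digit j)%:~R) else 0.
have VU I : word_value tau I = U (rev I).
  elim/last_ind: I => [|I j IHI]; first exact: word_value_nil.
  by rewrite word_value_rcons IHI /tau rev_rcons/= size_rev.
have tauE I j : tau (rcons I j) =
    dig (e (word_value tau I, size I) + vecq * (digit j)%:~R).
  by rewrite /tau rev_rcons size_rev -VU.
have tauG : Gamma_valued tau by move=> I j; rewrite tauE; apply: (hdig _).1.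
have tauB : branching tau.
  move=> I; exists (e (word_value tau I, size I)); split; first exact: (he _ _).1.
  by move=> j; rewrite tauE; apply: (hdig _).2.
have dense I : exists2 x, M x & modA (size I) x (word_value tau I).
  elim/last_ind: I => [|I j IHI].
    by exists 0 => //; rewrite word_value_nil; exact: modA_refl.
  have [x [t [Mx [m hm]]]] := (he _ _).2 IHI.
  (* The element x sits in the child with factor t; shifting by j - t reaches the child j. *)
  have [y [My [p hp]]] := maximal_full (size I) (digit j - t) Mx.
  exists y => //; rewrite size_rcons word_value_rcons tauE.
  apply: modA_trans _ (modA_shift _ (modA_sym (hdig _).2) _).
  by exists (m + p); rewrite [RHS]mulrDr -hm -hp intrB; ring.
have step x I : M x -> modA (size I) x (word_value tau I) ->
    exists i, modA (size I).+1 x (word_value tau (rcons I i)).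
  move=> Mx xI; have [y My yI] := dense (rcons I zero3).
  rewrite size_rcons in yI.
  exact: (tree_step tauB xI yI (M_orth Mx My)).
have digitz : digit zero3 = 0 by [].
have zeros k : word_value tau (nseq k zero3) = 0 /\
    forall i, tau (rcons (nseq k zero3) i) = vq q1 q2 i.
  have tauz n i : word_value tau (nseq n zero3) = 0 ->
      tau (rcons (nseq n zero3) i) = vq q1 q2 i.
    move=> h; rewrite tauE h e0 add0r -vqE; apply: Gamma_inj.
    - exact: (hdig _).1.
    - exact: vq_in_Gamma.
    - exact: (hdig _).2.
  elim: k => [|k [IH1 IH2]].
    by split; [|move=> i; apply: tauz]; exact: word_value_nil.
  suff h : word_value tau (nseq k.+1 zero3) = 0 by split=> // i; apply: tauz.
  have -> : nseq k.+1 zero3 = rcons (nseq k zero3) zero3.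
    by rewrite -cats1 -(addn1 k) nseqD.
  by rewrite word_value_rcons IH1 IH2 vqE digitz mulr0 mulr0 addr0.
exists tau; split; last first.
  have MT x : M x -> tree_set tau x.
    move=> Mx; have [I||w [_ hw]] := @tree_path tau x [::].
    - exact: step.
    - by rewrite word_value_nil; exists x; rewrite mul1r subr0.
    by exists w; exact: tree_limit.
  move=> x; split=> [|xT]; first exact: MT.
  apply: M_max => y My.
  have [->|/eqP xy] := eqVneq x y; first by left; rewrite subrr.
  by right; apply: tree_set_orth tauB xT (MT _ My) xy.
split; first by case/lastP => // I j _; exact: tauG.
split; first by move=> k i; rewrite cats1; exact: (zeros k).2.
split.
  move=> I _ _; have [f [fE hf]] := tauB I; exists f; split=> // j.
  by apply/congAP; rewrite !vqE; exact: hf.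
move=> I _; have [x Mx xI] := dense I.
have [w [wI hw]] := tree_path (fun J => step x J Mx) xI.
have [N hN] := tree_limit tauG hw.
have wz n : (N <= n)%N -> w n = zero3.
  move=> Nn; have [f [fE hf]] := tauB (Defs.prefix w n).
  apply: (in_E_digit0 fE); rewrite -[0](hN n.+1 _).1; last by lia.
  by rewrite prefixS; exact: hf.
(* The cut lies beyond N, so every later letter of [w] is zero, and the successor makes [J]
   nonempty. *)
exists (drop (size I) (Defs.prefix w (size I + N).+1)); split.
  by rewrite size_drop size_prefix; lia.
exists 0%N => n _.
have -> : I ++ drop (size I) (Defs.prefix w (size I + N).+1) ++ nseq n zero3 =
    Defs.prefix w ((size I + N).+1 + n).
  have takeI : take (size I) (Defs.prefix w (size I + N).+1) = I.
    rewrite -[RHS]wI; apply: (@eq_from_nth _ zero3).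
      by rewrite size_takel !size_prefix//; lia.
    move=> i; rewrite size_takel ?size_prefix; last by lia.
    by move=> iI; rewrite nth_take// !nth_mkseq//; lia.
  rewrite catA -{1}takeI cat_take_drop; apply: (@eq_from_nth _ zero3).
    by rewrite size_cat size_nseq !size_prefix.
  rewrite size_cat size_nseq size_prefix => i hi.
  rewrite nth_cat size_prefix [RHS]nth_mkseq//; case: ltnP => hi'.
    by rewrite nth_mkseq.
  by rewrite nth_nseq if_same wz//; lia.
by apply: (hN _ _).1; lia.
Qed.

End ToTreeMapping.

End Lattice.

(** * Orthogonality of exponentials as a lattice condition *)

Section Orthogonality.
Variables (R : realType) (q1 q2 : nat).
Implicit Types x y z : int * int.

Lemma embZ2_inj : injective (embZ2 R).
Proof. by move=> [x1 x2] [y1 y2] [/intr_inj -> /intr_inj ->]. Qed.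

Lemma embZ2B x y : embZ2 R (x - y) =
  ((embZ2 R x).1 - (embZ2 R y).1, (embZ2 R x).2 - (embZ2 R y).2).
Proof. by rewrite /embZ2/= !intrB. Qed.

Lemma embZ2_level k (t a b : int) :
  embZ2 R (matA q1 q2 ^+ k * (vecq q1 q2 * t%:~R) + matA q1 q2 ^+ k.+1 * (a, b)) =
  ((3 * q1)%:R ^+ k.+1 * (t%:~R / 3 + a%:~R),
   (3 * q2)%:R ^+ k.+1 * (b%:~R - t%:~R / 3)).
Proof.
rewrite !matA_expr intr_pair /embZ2; congr pair => /=.
  by rewrite intrD !intrM -!pmulrn !natrX exprSr natrM; field.
by rewrite intrD !intrM intrN -!pmulrn !natrX exprSr natrM; field.
Qed.

Lemma tau_star_setE (tau : seq 'I_3 -> int * int) :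
  tau_star_set R q1 q2 tau = embZ2 R @` tree_set q1 q2 tau.
Proof.
apply/seteqP; split=> [l [w [[N hN] [z [[N0 hz] ->]]]]|_ [z [w [N hw]] <-]].
  exists z => //; exists w, (N + N0)%N => n hn; split; first by apply: hN; lia.
  by rewrite -tau_partialE hz//; lia.
exists w; split; first by exists N => n /hw[].
by exists z; split=> //; exists N => n /hw[_ <-]; rewrite tau_partialE.
Qed.

Hypotheses (q1_gt0 : (0 < q1)%N) (q2_gt0 : (0 < q2)%N).

Lemma exp_orth_orth_diff (mu : probability (R * R)%type R) (l l' : R * R) :
  sierpinski_invariant q1 q2 mu ->
  exp_orth mu l l' <-> exists2 z, (l.1 - l'.1, l.2 - l'.2) = embZ2 R z &
    orth_diff q1 q2 z.
Proof.
move=> mu_inv; rewrite exp_orthE (fourier_sqnorm_eq0 q1_gt0 q2_gt0 mu_inv).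
move: (l.1 - l'.1) (l.2 - l'.2) => u1 u2.
have b1 n : (3 * q1)%:R ^+ n != 0 :> R by rewrite expf_neq0// pnatr_eq0; lia.
have b2 n : (3 * q2)%:R ^+ n != 0 :> R by rewrite expf_neq0// pnatr_eq0; lia.
split=> [[n /mask_eq0]|[z uz [k [t [t3 [[a b] h]]]]]].
  rewrite iter_scaleA/= => -[m [p [m3 h1 h2]]].
  (* The mask zero is (m/3, p - m/3), that is A^-1 (m v) + (0, p). *)
  exists (matA q1 q2 ^+ n * (vecq q1 q2 * m%:~R) + matA q1 q2 ^+ n.+1 * (0, p)).
    rewrite embZ2_level -h1 -h2; congr pair; move: (b1 n.+1) (b2 n.+1).
      by move: (_ ^+ _) (_ ^+ _) => c1 c2 c10 c20; field; rewrite c10.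
    by move: (_ ^+ _) (_ ^+ _) => c1 c2 c10 c20; field; rewrite c10 c20.
  by exists n, m; split=> //; exists (0, p); ring.
have {h}zE : z = matA q1 q2 ^+ k * (vecq q1 q2 * t%:~R) + matA q1 q2 ^+ k.+1 * (a, b).
  by rewrite -h; ring.
move: uz; rewrite zE embZ2_level => -[-> ->].
exists k; apply/mask_eq0; rewrite iter_scaleA/=; exists (t + 3 * a), (a + b).
split; first by lia.
- by rewrite mulrAC mulfV// mul1r intrD intrM; field.
- by rewrite ![_ * _ / _]mulrAC !mulfV// !mul1r intrD; field.
Qed.

End Orthogonality.

Theorem theorem1p1 (R : realType) (q1 q2 : nat)
  (mu : probability (R * R)%type R) (Lambda : set (R * R)) :
  (1 <= q1)%N -> (q1 <= q2)%N ->
  sierpinski_invariant q1 q2 mu ->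
  countable Lambda -> Lambda (0, 0) ->
  (maximal_orthogonal_set mu Lambda <->
   exists tau : seq 'I_3 -> int * int,
     maximal_tree_mapping q1 q2 tau /\ Lambda = tau_star_set R q1 q2 tau).
Proof.
move=> q1_gt0 q12 mu_inv cL L0; have q2_gt0 := leq_trans q1_gt0 q12.
have orthE l l' := exp_orth_orth_diff q1_gt0 q2_gt0 l l' mu_inv.
have orthZ x y : exp_orth mu (embZ2 R x) (embZ2 R y) <-> orth_diff q1 q2 (x - y).
  rewrite orthE -embZ2B; split=> [[z /embZ2_inj -> //]|xy].
  by exists (x - y).
have emb0 : embZ2 R 0 = (0, 0) by [].
have integral_set L : orthogonal_set mu L -> L (0, 0) ->
    forall l, L l -> exists z, l = embZ2 R z.
  move=> [_ oL] L00 l Ll; have [->|/eqP l0] := eqVneq l (0, 0); first by exists 0.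
  have /orthE[z + _] := oL l (0, 0) Ll L00 l0.
  by rewrite !subr0 -surjective_pairing => ->; exists z.
have orth_eq L x y : orthogonal_set mu L -> L (embZ2 R x) -> L (embZ2 R y) ->
    x - y = 0 \/ orth_diff q1 q2 (x - y).
  move=> [_ oL] Lx Ly; have [->|/eqP xy] := eqVneq x y; first by left; rewrite subrr.
  by right; apply/orthZ/oL => // /embZ2_inj.
split=> [[oL maxL]|[tau [tauM LE]]]; last first.
  have TL z : tree_set q1 q2 tau z -> Lambda (embZ2 R z).
    by rewrite LE tau_star_setE => zT; exists z.
  split.
    split=> // l l'; rewrite LE tau_star_setE => -[x xT <-] [y yT <-] xy.
    apply/orthZ; apply: tree_set_orth xT yT _ => //.
      exact: tree_mapping_branching.
    by move=> xyE; apply: xy; rewrite xyE.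
  move=> L' oL' LL'; apply/seteqP; split=> // l Ll.
  have [x xE] := integral_set _ oL' (LL' _ L0) _ Ll.
  rewrite xE; apply: (TL); apply: (tree_mapping_maximal q1_gt0 q2_gt0 tauM) => y yT.
  by apply: (orth_eq L') => //; [rewrite -xE|apply: LL'; exact: TL].
have [||x hx|tau [tauM tauE]] :=
    @exists_tree_mapping q1 q2 q1_gt0 q2_gt0 (fun z => Lambda (embZ2 R z)).
- by rewrite emb0.
- by move=> x y; exact: orth_eq.
(* Maximality of [Lambda] absorbs any integer point orthogonal to all of its integer points,
   provided the enlarged set is orthogonal and countable; the latter holds since it lies in the
   image of Z^2. *)
- suff oL' : orthogonal_set mu (Lambda `|` [set embZ2 R x]).
    have <- := maxL _ oL'; first by right.
    by move=> l; left.
  split.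
    have cZ : countable (embZ2 R @` setT).
      by apply: sub_countable (card_image_le _ _) _; exact: countableP.
    apply: sub_countable (subset_card_le _) cZ => l [Ll|->]; last by exists x.
    by have [z ->] := integral_set _ oL L0 _ Ll; exists z.
  have hxl l : Lambda l -> embZ2 R x <> l ->
      exp_orth mu (embZ2 R x) l /\ exp_orth mu l (embZ2 R x).
    move=> Ll; have [y yE] := integral_set _ oL L0 _ Ll; rewrite yE => xy.
    have Ly : Lambda (embZ2 R y) by rewrite -yE.
    have [/eqP|oxy] := hx y Ly.
      by rewrite subr_eq0 => /eqP xyE; exfalso; apply: xy; rewrite xyE.
    split; first exact/orthZ.
    by apply/orthZ; rewrite -opprB; exact: orth_diffN.
  move=> l l' [Ll|->] [Ll'|->] ll'.
  + by case: oL => _; apply.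
  + by apply: (hxl l Ll _).2; exact/nesym.
  + exact: (hxl l' Ll' _).1.
  + by [].
exists tau; split=> //; rewrite tau_star_setE; apply/seteqP; split=> [l Ll|_ [z zT <-]].
  have [z zE] := integral_set _ oL L0 _ Ll; exists z => //.
  by apply/tauE; rewrite -zE.
exact/tauE.
Qed.
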